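(* Let $(A,\ast,\alpha)$ be a multiplicative Hom-Malcev algebra. Define a ternary operation on $A$ by $$(x,y,z)_{\alpha}:=\tfrac13\{x,y,z\}_{\alpha},\qquad \{x,y,z\}_{\alpha}=-J_{\alpha}(x,y,z)+3(x\ast y)\ast\alpha(z)\qquad (x,y,z\in A).$$ Then $(A,\ast,(,,)_{\alpha},\alpha)$ is a Hom-Bol algebra.
   Context: All vector spaces and algebras are over an algebraically closed field $\mathbb{K}$ of characteristic $0$. A Hom-algebra is a triple $(A,\ast,\alpha)$ where $A$ is a $\mathbb{K}$-vector space, $\ast:A\times A\to A$ is bilinear and $\alpha:A\to A$ is linear. It is multiplicative if $\alpha(x\ast y)=\alpha(x)\ast\alpha(y)$ for all $x,y\in A$. Its Hom-Jacobian is $J_\alpha(x,y,z)=(x\ast y)\ast\alpha(z)+(y\ast z)\ast\alpha(x)+(z\ast x)\ast\alpha(y)$. Powers $\alpha^k$ denote $k$-fold composition. A Hom-Malcev algebra is a Hom-algebra $(A,\ast,\alpha)$ such that $\ast$ is anticommutative and $J_\alpha(\alpha(x),\alpha(y),x\ast z)=J_\alpha(x,y,z)\ast\alpha^2(x)$ for all $x,y,z\in A$. A Hom-Bol algebra is a quadruple $(A,[,],(,,),\alpha)$ with $A$ a $\mathbb{K}$-vector space, $[,]$ a bilinear operation, $(,,)$ a trilinear operation on $A$, and $\alpha:A\to A$ linear such that, for all $u,v,w,x,y,z\in A$: (HB1) $\alpha([x,y])=[\alpha(x),\alpha(y)]$; (HB2) $\alpha((x,y,z))=(\alpha(x),\alpha(y),\alpha(z))$;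 (HB3) $[x,y]=-[y,x]$; (HB4) $(x,y,z)=-(y,x,z)$; (HB5) $(x,y,z)+(y,z,x)+(z,x,y)=0$; (HB6) $(\alpha(x),\alpha(y),[u,v])=[(x,y,u),\alpha^2(v)]+[\alpha^2(u),(x,y,v)]+(\alpha(u),\alpha(v),[x,y])-[[\alpha(u),\alpha(v)],[\alpha(x),\alpha(y)]]$; (HB7) $(\alpha^2(x),\alpha^2(y),(u,v,w))=((x,y,u),\alpha^2(v),\alpha^2(w))+(\alpha^2(u),(x,y,v),\alpha^2(w))+(\alpha^2(u),\alpha^2(v),(x,y,w))$. *)

(* Defs.v *)
From mathcomp Require Import all_boot all_algebra.

Set Implicit Arguments.
Unset Strict Implicit.
Unset Printing Implicit Defensive.

Import GRing.Theory.
Local Open Scope ring_scope.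

Definition trilinear_op (K : fieldType) (A : lmodType K)
    (t : A -> A -> A -> A) : Prop :=
  [/\ forall y z, linear (fun x => t x y z),
      forall x z, linear (fun y => t x y z) &
      forall x y, linear (fun z => t x y z)].

Definition hom_algebra (K : fieldType) (A : lmodType K)
    (m : A -> A -> A) (alpha : A -> A) : Prop :=
  bilinear_for *:%R *:%R m /\ linear alpha.

Definition multiplicative (K : fieldType) (A : lmodType K)
    (m : A -> A -> A) (alpha : A -> A) : Prop :=
  forall x y, alpha (m x y) = m (alpha x) (alpha y).

Definition hom_jacobian (K : fieldType) (A : lmodType K)
    (m : A -> A -> A) (alpha : A -> A) (x y z : A) : A :=
  m (m x y) (alpha z) + m (m y z) (alpha x) + m (m z x) (alpha y).

Record hom_malcev (K : fieldType) (A : lmodType K)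
    (m : A -> A -> A) (alpha : A -> A) : Prop := HomMalcev {
  hom_malcev_algebra : hom_algebra m alpha;
  hom_malcev_anticomm : forall x y, m x y = - m y x;
  hom_malcev_id : forall x y z,
    hom_jacobian m alpha (alpha x) (alpha y) (m x z)
      = m (hom_jacobian m alpha x y z) (iter 2 alpha x)
}.

Record hom_bol (K : fieldType) (A : lmodType K)
    (b : A -> A -> A) (t : A -> A -> A -> A) (alpha : A -> A) : Prop := HomBol {
  hom_bol_bilinear : bilinear_for *:%R *:%R b;
  hom_bol_trilinear : trilinear_op t;
  hom_bol_linear : linear alpha;
  HB1 : forall x y, alpha (b x y) = b (alpha x) (alpha y);
  HB2 : forall x y z, alpha (t x y z) = t (alpha x) (alpha y) (alpha z);
  HB3 : forall x y, b x y = - b y x;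
  HB4 : forall x y z, t x y z = - t y x z;
  HB5 : forall x y z, t x y z + t y z x + t z x y = 0;
  HB6 : forall x y u v,
    t (alpha x) (alpha y) (b u v)
      = b (t x y u) (iter 2 alpha v) + b (iter 2 alpha u) (t x y v)
        + t (alpha u) (alpha v) (b x y)
        - b (b (alpha u) (alpha v)) (b (alpha x) (alpha y));
  HB7 : forall x y u v w,
    t (iter 2 alpha x) (iter 2 alpha y) (t u v w)
      = t (t x y u) (iter 2 alpha v) (iter 2 alpha w)
        + t (iter 2 alpha u) (t x y v) (iter 2 alpha w)
        + t (iter 2 alpha u) (iter 2 alpha v) (t x y w)
}.

Definition brace_op (K : fieldType) (A : lmodType K)
    (m : A -> A -> A) (alpha : A -> A) (x y z : A) : A :=
  - hom_jacobian m alpha x y z + 3 *: m (m x y) (alpha z).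

Definition ternary_op (K : fieldType) (A : lmodType K)
    (m : A -> A -> A) (alpha : A -> A) (x y z : A) : A :=
  3^-1 *: brace_op m alpha x y z.

(* Main.v *)
Require Import Defs.
From mathcomp Require Import all_boot all_algebra.

Import GRing.Theory.
(* Restores [multiplicative], which GRing.Theory shadows. *)
Import Defs.

Local Open Scope ring_scope.

(** Write L_a for left multiplication by a, J for the Hom-Jacobian and {x,y,z}
    for the brace.  For readability the powers of alpha are left out here:
    alpha being multiplicative, each homogeneous identity carries the twists
    that its bracketing forces, and the untwisted argument goes through.

    The Malcev identity says that the function
      S(x,y,z,w) = J(xy,z,w) - J(x,y,z)w + J(x,y,w)z
    vanishes when x = z ([sagle_rep]).  Since S is visibly skew in x,y and in
    z,w, it is alternating in all four arguments.  Two facts about S suffice.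

    - The defect of L_a as a derivation, evaluated on the left-normed product
      (uv)w, is -S(u,v,w,a) - J(u,v,w)a ([mul_left_normed]).  This is invariant
      under cyclic rotation of u,v,w, and {u,v,w} = 2(uv)w - (vw)u - (wu)v has
      coefficients of sum zero, so every L_a is a derivation of the brace
      ([mul_brace]).  As {x,y,-} = 2L_{xy} + [L_x,L_y], it is a derivation of
      the brace too, which is HB7 ([brace_brace]).

    - Expanding x J(y,z,w) by the same formula and comparing with the
      definition of S expresses 3S through the products J(.,.,.)v ([sagle3]).
      Computing how far 2L_{xy} + [L_x,L_y] is from a derivation of the binary
      product gives a combination of S and such products, which collapses to
      -J(xy,u,v) ([brace_mul]).  By the definition of {u,v,xy} this is HB6.

    The remaining axioms are immediate from the explicit form of the brace. *)

(** * Linear combinations in an abelian group *)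

(** The identities below end in the comparison of two integer combinations of
    the same vectors.  They are decided by reflection: two expressions agree
    as soon as every atom occurs in them with the same coefficient. *)
Inductive zexpr :=
  ZVar of nat | ZZero | ZAdd of zexpr & zexpr | ZOpp of zexpr.

Fixpoint zval {V : zmodType} (env : seq V) (e : zexpr) : V :=
  match e with
  | ZVar k => env`_k
  | ZZero => 0
  | ZAdd e1 e2 => zval env e1 + zval env e2
  | ZOpp e1 => - zval env e1
  end.

Fixpoint zcoef (e : zexpr) (i : nat) : int :=
  match e with
  | ZVar k => (k == i)%:R
  | ZZero => 0
  | ZAdd e1 e2 => zcoef e1 i + zcoef e2 i
  | ZOpp e1 => - zcoef e1 i
  end.

Lemma zval_sum {V : zmodType} (env : seq V) e :
  zval env e = \sum_(i < size env) env`_i *~ zcoef e i.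
Proof.
elim: e => [k||e1 IH1 e2 IH2|e1 IH1] /=.
- have [k_lt|k_ge] := ltnP k (size env).
    rewrite (bigD1 (Ordinal k_lt)) //= eqxx big1 ?addr0 // => i /negPf nik.
    by rewrite eq_sym -(inj_eq val_inj) /= in nik; rewrite nik mulr0z.
  rewrite nth_default // big1 // => i _.
  by rewrite gtn_eqF ?mulr0z // (leq_trans (ltn_ord i)).
- by rewrite big1.
- by rewrite IH1 IH2 -big_split; apply: eq_bigr => i _; rewrite mulrzDr.
- by rewrite IH1 -sumrN; apply: eq_bigr => i _; rewrite mulrNz.
Qed.

Lemma zval_eq {V : zmodType} (env : seq V) e1 e2 :
  all (fun i => zcoef e1 i == zcoef e2 i) (iota 0 (size env)) ->
  zval env e1 = zval env e2.
Proof.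
move=> /allP e12; rewrite !zval_sum; apply: eq_bigr => i _.
by rewrite (eqP (e12 i _)) // mem_iota ltn_ord.
Qed.

Ltac zindex x env :=
  lazymatch env with
  | x :: _ => constr:(O)
  | _ :: ?env' => let k := zindex x env' in constr:(S k)
  end.

Ltac zatoms t env :=
  lazymatch t with
  | @GRing.add _ ?a ?b => let env1 := zatoms a env in zatoms b env1
  | @GRing.opp _ ?a => zatoms a env
  | @GRing.zero _ => env
  | _ => match env with
         | _ => let _ := zindex t env in env
         | _ => constr:(t :: env)
         end
  end.

Ltac zreify t env :=
  lazymatch t with
  | @GRing.add _ ?a ?b =>
      let ea := zreify a env in let eb := zreify b env in constr:(ZAdd ea eb)
  | @GRing.opp _ ?a => let ea := zreify a env in constr:(ZOpp ea)
  | @GRing.zero _ => constr:(ZZero)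
  | _ => let k := zindex t env in constr:(ZVar k)
  end.

Ltac zmod_eq :=
  lazymatch goal with
  | |- @eq ?V ?a ?b =>
      let env0 := zatoms a (@nil V) in
      let env := zatoms b env0 in
      let ea := zreify a env in
      let eb := zreify b env in
      refine (@zval_eq _ env ea eb _); vm_compute; reflexivity
  end.

(** * Multiplicative Hom-Malcev algebras *)

Section HomMalcev.
Context {K : fieldType} (charK0 : [pchar K] =i pred0).
Context {A : lmodType K} {m : A -> A -> A} {alpha : A -> A}.
Context (malcevA : hom_malcev m alpha) (multA : multiplicative m alpha).

Local Notation "x ** y" := (m x y) (at level 38, left associativity).
Local Notation J := (hom_jacobian m alpha).
Local Notation brace := (brace_op m alpha).
Local Notation t := (ternary_op m alpha).

Lemma mulDl x y z : (x + y) ** z = x ** z + y ** z.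
Proof.
have [[lin_l _] _] := hom_malcev_algebra malcevA.
by have /= := lin_l z 1 x y; rewrite !scale1r.
Qed.

Lemma mulDr x y z : x ** (y + z) = x ** y + x ** z.
Proof.
have [[_ lin_r] _] := hom_malcev_algebra malcevA.
by have /= := lin_r x 1 y z; rewrite !scale1r.
Qed.

Lemma mul0l x : 0 ** x = 0.
Proof. by apply: (addrI (0 ** x)); rewrite -mulDl !addr0. Qed.

Lemma mul0r x : x ** 0 = 0.
Proof. by apply: (addrI (x ** 0)); rewrite -mulDr !addr0. Qed.

Lemma mulNl x y : (- x) ** y = - (x ** y).
Proof. by apply: (addrI (x ** y)); rewrite -mulDl !subrr mul0l. Qed.

Lemma mulNr x y : x ** (- y) = - (x ** y).
Proof. by apply: (addrI (x ** y)); rewrite -mulDr !subrr mul0r. Qed.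

Lemma mulZl c x y : (c *: x) ** y = c *: (x ** y).
Proof.
have [[lin_l _] _] := hom_malcev_algebra malcevA.
by have /= := lin_l y c x 0; rewrite mul0l !addr0.
Qed.

Lemma mulZr c x y : x ** (c *: y) = c *: (x ** y).
Proof.
have [[_ lin_r] _] := hom_malcev_algebra malcevA.
by have /= := lin_r x c y 0; rewrite mul0r !addr0.
Qed.

Lemma alphaD x y : alpha (x + y) = alpha x + alpha y.
Proof.
have [_ lin] := hom_malcev_algebra malcevA.
by have /= := lin 1 x y; rewrite !scale1r.
Qed.

Lemma alpha0 : alpha 0 = 0.
Proof. by apply: (addrI (alpha 0)); rewrite -alphaD !addr0. Qed.

Lemma alphaN x : alpha (- x) = - alpha x.
Proof. by apply: (addrI (alpha x)); rewrite -alphaD !subrr alpha0. Qed.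

Lemma alphaZ c x : alpha (c *: x) = c *: alpha x.
Proof.
have [_ lin] := hom_malcev_algebra malcevA.
by have /= := lin c x 0; rewrite alpha0 !addr0.
Qed.

Definition linE := (mulDl, mulDr, mulNl, mulNr, alphaD, alphaN).

Lemma mul_anticomm x y : x ** y = - (y ** x).
Proof. exact: (hom_malcev_anticomm malcevA). Qed.

Lemma natS_neq0 n : n.+1%:R != 0 :> K.
Proof. by have /pcharf0P -> := charK0. Qed.

Lemma double_inj : injective (fun x : A => x + x).
Proof.
move=> x y /=; rewrite -!mulr2n -!scaler_nat.
by move=> /(scalerI (natS_neq0 1)).
Qed.

Lemma jac_cyc x y z : J x y z = J y z x.
Proof. by rewrite /hom_jacobian; zmod_eq. Qed.

Lemma jacC x y z : J x y z = - J y x z.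
Proof.
rewrite /hom_jacobian (mul_anticomm y x) (mul_anticomm x z).
by rewrite (mul_anticomm z y) !linE; zmod_eq.
Qed.

Lemma jacNl x y z : J (- x) y z = - J x y z.
Proof. by rewrite /hom_jacobian !linE; zmod_eq. Qed.

Lemma jacC23 x y z : J x y z = - J x z y.
Proof. by rewrite (jac_cyc x z) (jacC z) opprK jac_cyc. Qed.

Lemma jac_rep x y : J x y x = 0.
Proof.
by apply: double_inj; rewrite {1}jac_cyc (jacC y x x) addNr addr0.
Qed.

(** The Hom-Jacobian measures how far a left multiplication is from being a
    derivation. *)
Lemma mul_leibniz a u v :
  alpha a ** (u ** v) = a ** u ** alpha v + alpha u ** (a ** v) - J a u v.
Proof.
rewrite /hom_jacobian (mul_anticomm (alpha a)) (mul_anticomm (alpha u)).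
by rewrite (mul_anticomm v a) !linE; zmod_eq.
Qed.

Lemma braceE x y z :
  brace x y z
  = x ** y ** alpha z + x ** y ** alpha z
    - y ** z ** alpha x - z ** x ** alpha y.
Proof.
rewrite /brace_op /hom_jacobian scaler_nat !mulrS mulr0n.
by zmod_eq.
Qed.

(** In terms of left multiplications, {x,y,-} = 2L_{xy} + [L_x,L_y]; this form
    makes derivation properties of the brace follow from those of the L_a. *)
Lemma braceE_ad x y z :
  brace x y z
  = x ** y ** alpha z + x ** y ** alpha z
    + alpha x ** (y ** z) - alpha y ** (x ** z).
Proof.
rewrite braceE (mul_anticomm (y ** z)) (mul_anticomm z x) mulNl.
by rewrite (mul_anticomm (x ** z)); zmod_eq.
Qed.

(** * The Sagle function is alternating *)

(** The order of the arguments is chosen so that skew-symmetry in the first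
    two and in the last two holds for any anticommutative product; the
    Malcev identity then supplies exactly the missing transposition. *)
Definition sagle x y z w : A :=
  J (x ** y) (alpha z) (alpha w) - J x y z ** alpha (alpha w)
    + J x y w ** alpha (alpha z).

Lemma sagleC12 x y z w : sagle x y z w = - sagle y x z w.
Proof.
rewrite /sagle (mul_anticomm x y) jacNl (jacC x y z) (jacC x y w) !linE.
by zmod_eq.
Qed.

(** This is the Malcev identity, read through J(xy,x,w) = J(x,w,xy). *)
Lemma sagle_rep x y w : sagle x y x w = 0.
Proof.
rewrite /sagle jac_cyc (hom_malcev_id malcevA) jac_rep mul0l.
by rewrite (jac_cyc x w y) (jac_cyc w y x) (jacC y x w) !linE; zmod_eq.
Qed.

(** Polarization of [sagle_rep] at x + z. *)
Lemma sagleC13 x y z w : sagle x y z w = - sagle z y x w.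
Proof.
apply/eqP; rewrite -addr_eq0 -(sagle_rep (x + z) y w); apply/eqP.
transitivity (sagle x y x w + sagle x y z w + sagle z y x w + sagle z y z w).
  by rewrite !sagle_rep; zmod_eq.
by rewrite /sagle /hom_jacobian !linE; zmod_eq.
Qed.

Lemma sagle_cyc x y z w : sagle x y z w = sagle y z x w.
Proof. by rewrite sagleC13 sagleC12 opprK. Qed.

Lemma sagleC34 x y z w : sagle x y z w = - sagle x y w z.
Proof.
rewrite /sagle [J (_ ** _) _ _]jac_cyc jacC [J (alpha w) _ _]jac_cyc.
by rewrite [J (alpha z) (_ ** _) _]jac_cyc; zmod_eq.
Qed.

Lemma sagle_rot x y z w : sagle x y z w = - sagle y z w x.
Proof. by rewrite sagle_cyc sagleC34. Qed.

Lemma jac_mul x y z w :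
  J (x ** y) (alpha z) (alpha w)
  = sagle x y z w + J x y z ** alpha (alpha w) - J x y w ** alpha (alpha z).
Proof. by rewrite /sagle; zmod_eq. Qed.

(** * Left multiplications are derivations of the brace *)

(** Two applications of the Leibniz rule; the two Jacobian defects combine into
    S(u,v,w,a) + J(u,v,w)a because J(a,uv,w) = J(uv,w,a). *)
Lemma mul_left_normed a u v w :
  alpha (alpha a) ** (u ** v ** alpha w)
  = a ** u ** alpha v ** alpha (alpha w)
    + alpha u ** (a ** v) ** alpha (alpha w)
    + alpha (u ** v) ** alpha (a ** w)
    - (sagle u v w a + J u v w ** alpha (alpha a)).
Proof.
rewrite mul_leibniz (mul_leibniz a u v) /sagle /hom_jacobian !linE !multA.
by zmod_eq.
Qed.

(** The three left-normed terms of the brace have coefficients 2, -1, -1, and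
    their defects are equal by cyclic invariance, so the defects cancel. *)
Lemma mul_brace a u v w :
  alpha (alpha a) ** brace u v w
  = brace (a ** u) (alpha v) (alpha w) + brace (alpha u) (a ** v) (alpha w)
    + brace (alpha u) (alpha v) (a ** w).
Proof.
rewrite !braceE !linE !mul_left_normed.
rewrite -(sagle_cyc w) -(sagle_cyc v) -!(jac_cyc w) -!(jac_cyc v).
by rewrite !multA; zmod_eq.
Qed.

Lemma alpha_brace x y z :
  alpha (brace x y z) = brace (alpha x) (alpha y) (alpha z).
Proof. by rewrite !braceE !linE !multA. Qed.

Lemma braceDl x x' y z : brace (x + x') y z = brace x y z + brace x' y z.
Proof. by rewrite !braceE !linE; zmod_eq. Qed.

Lemma braceDm x y y' z : brace x (y + y') z = brace x y z + brace x y' z.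
Proof. by rewrite !braceE !linE; zmod_eq. Qed.

Lemma braceDr x y z z' : brace x y (z + z') = brace x y z + brace x y z'.
Proof. by rewrite !braceE !linE; zmod_eq. Qed.

Lemma braceNl x y z : brace (- x) y z = - brace x y z.
Proof. by rewrite !braceE !linE; zmod_eq. Qed.

Lemma braceNm x y z : brace x (- y) z = - brace x y z.
Proof. by rewrite !braceE !linE; zmod_eq. Qed.

Lemma braceNr x y z : brace x y (- z) = - brace x y z.
Proof. by rewrite !braceE !linE; zmod_eq. Qed.

Definition braceDE := (braceDl, braceDm, braceDr, braceNl, braceNm, braceNr).

(** Twisted derivations are closed under sums and commutators. *)
Lemma brace_brace x y u v w :
  brace (alpha (alpha x)) (alpha (alpha y)) (brace u v w)
  = brace (brace x y u) (alpha (alpha v)) (alpha (alpha w))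
    + brace (alpha (alpha u)) (brace x y v) (alpha (alpha w))
    + brace (alpha (alpha u)) (alpha (alpha v)) (brace x y w).
Proof.
rewrite braceE_ad alpha_brace -!multA !mul_brace.
(* The explicit braces prevent [mulDr] from unfolding a brace as a sum. *)
rewrite !(mulDr _ (_ + _) (brace _ _ _)) !mul_brace.
by rewrite !(braceE_ad x y) !braceDE !multA; zmod_eq.
Qed.

(** * The brace acting on the binary product *)

(** Summing [mul_left_normed] over the cyclic rotations of y,z,w; the terms free
    of defect regroup into Jacobians with one argument multiplied by x. *)
Lemma mul_jac x y z w :
  alpha (alpha x) ** J y z w
  = J (x ** y) (alpha z) (alpha w) + J (x ** z) (alpha w) (alpha y)
    + J (x ** w) (alpha y) (alpha z)
    - (sagle y z w x + sagle z w y x + sagle w y z x)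
    - (J y z w + J y z w + J y z w) ** alpha (alpha x).
Proof.
rewrite /hom_jacobian !linE !mul_left_normed /hom_jacobian !linE !multA.
by zmod_eq.
Qed.

(** Replace each Jacobian of a product in [mul_jac] by [jac_mul].  By alternation
    all six values of S agree up to sign and add up to 6S; halving leaves 3S. *)
Lemma sagle3 x y z w :
  sagle x y z w + sagle x y z w + sagle x y z w
  = J y z w ** alpha (alpha x) - J x z w ** alpha (alpha y)
    + J x y w ** alpha (alpha z) - J x y z ** alpha (alpha w).
Proof.
(* The product x J(y,z,w) is added to both sides: anticommutativity rewrites it
   on the left, [mul_jac] on the right. *)
apply: double_inj; apply: (addIr (alpha (alpha x) ** J y z w)) => /=.
rewrite [in RHS]mul_jac !jac_mul.
rewrite (sagle_rot x y) (sagle_rot x z) (sagle_rot x w).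
rewrite (sagle_cyc w y) -(sagle_cyc y z).
rewrite mul_anticomm (jacC23 x z y) (jacC23 x w z) (jacC23 x w y) !linE.
by zmod_eq.
Qed.

(** Expand with [braceE_ad] and apply the Leibniz rule at each level.  The
    Jacobian defects, rewritten through S, amount to the two sides of
    [sagle3]. *)
Lemma brace_mul x y u v :
  brace (alpha x) (alpha y) (u ** v)
  = brace x y u ** alpha (alpha v) + alpha (alpha u) ** brace x y v
    - J (x ** y) (alpha u) (alpha v).
Proof.
have rot a b c d : sagle b c d a = - sagle a b c d.
  by rewrite (sagle_rot a) opprK.
(* The defects contain 3S with coefficient one: adding 3S to both sides, in its
   two forms, cancels them. *)
apply: (addIr (sagle x y u v + sagle x y u v + sagle x y u v)).
rewrite [in LHS]sagle3 !braceE_ad -multA (multA u) mul_leibniz.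
rewrite (mul_leibniz y) (mul_leibniz x) !mulDr !mulNr.
rewrite (mul_leibniz _ (y ** u)) (mul_leibniz _ (x ** u)).
rewrite (mul_leibniz _ _ (y ** v)) (mul_leibniz _ _ (x ** v)).
rewrite !(jac_cyc _ (_ ** _)) -!(jac_cyc (_ ** _)) !jac_mul.
rewrite (rot x y) (rot y x) -(sagle_cyc x y v) -(sagle_cyc y x v).
rewrite (sagleC34 x y v) (sagleC34 y x v) (sagleC12 y x).
rewrite !(mul_anticomm _ (J _ _ _)).
rewrite (jacC23 y v u) (jacC23 x v u) (jacC23 x u y) (jacC23 x v y).
by rewrite -(jac_cyc x y u) -(jac_cyc x y v) !linE !multA; zmod_eq.
Qed.

(** * The Hom-Bol structure *)

Lemma braceZl c x y z : brace (c *: x) y z = c *: brace x y z.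
Proof. by rewrite !braceE alphaZ !(mulZl, mulZr) !(scalerDr, scalerN). Qed.

Lemma braceZm c x y z : brace x (c *: y) z = c *: brace x y z.
Proof. by rewrite !braceE alphaZ !(mulZl, mulZr) !(scalerDr, scalerN). Qed.

Lemma braceZr c x y z : brace x y (c *: z) = c *: brace x y z.
Proof. by rewrite !braceE alphaZ !(mulZl, mulZr) !(scalerDr, scalerN). Qed.

Lemma hom_bol_ternary : hom_bol m t alpha.
Proof.
have [[lin_l lin_r] lin_a] := hom_malcev_algebra malcevA.
split=> //.
- split=> *; move=> c p q; rewrite /ternary_op.
  + by rewrite braceDl braceZl scalerDr !scalerA mulrC.
  + by rewrite braceDm braceZm scalerDr !scalerA mulrC.
  + by rewrite braceDr braceZr scalerDr !scalerA mulrC.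
- by move=> x y z; rewrite alphaZ alpha_brace.
- by move=> x y; apply: mul_anticomm.
- move=> x y z; rewrite /ternary_op -scalerN; congr (_ *: _).
  by rewrite !braceE (mul_anticomm x y) (mul_anticomm z x) (mul_anticomm z y) !linE; zmod_eq.
- move=> x y z; rewrite /ternary_op -!scalerDr !braceE.
  rewrite [X in _ *: X](_ : _ = 0) ?scaler0 //; zmod_eq.
- move=> x y u v; rewrite /ternary_op /=.
  apply: (scalerI (natS_neq0 2)).
  rewrite brace_mul mulZl mulZr !(scalerDr, scalerN) !scalerA mulfV ?natS_neq0 //.
  by rewrite !scale1r mul1r /brace_op /hom_jacobian !multA !scaler_nat; zmod_eq.
- move=> x y u v w; rewrite /ternary_op /=.
  by rewrite braceZl braceZm !braceZr -!scalerDr brace_brace.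
Qed.

End HomMalcev.

Theorem theorem3p5 (K : closedFieldType) (charK0 : [pchar K] =i pred0)
    (A : lmodType K) (m : A -> A -> A) (alpha : A -> A)
    (malcevA : hom_malcev m alpha) (multA : multiplicative m alpha) :
  hom_bol m (ternary_op m alpha) alpha.
Proof. exact: hom_bol_ternary. Qed.
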